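(* Let $n\ge1$ be an integer. For any finite-state stationary stochastic process $\mathbf{S}=\{S_1,S_2,\dots\}$ with values in $A_n=\{1,\dots,n\}$, the entropy rate and the permutation entropy rate are equal: $h(\mathbf{S})=h^*(\mathbf{S})$.
   Context: Stationarity means $\Pr\{S_1=s_1,\dots,S_L=s_L\}=\Pr\{S_{k+1}=s_1,\dots,S_{k+L}=s_L\}$ for all $k,L\ge1$ and $s_1,\dots,s_L\in A_n$. Write $p(s_1^L)=\Pr\{S_1=s_1,\dots,S_L=s_L\}$ for a word $s_1^L=s_1\cdots s_L\in A_n^L$. Logarithms are to base 2. $\mathcal{S}_L$ is the set of permutations of $\{1,\dots,L\}$. A word $s_1^L\in A_n^L$ is of type $\pi\in\mathcal{S}_L$ if for every $i=1,\dots,L-1$ we have $s_{\pi(i)}\le s_{\pi(i+1)}$, and $\pi(i)<\pi(i+1)$ whenever $s_{\pi(i)}=s_{\pi(i+1)}$. Each word has a unique type; $\phi:A_n^L\to\mathcal{S}_L$ sends a word to its type. For $\pi\in\mathcal{S}_L$ put $p(\pi)=\sum_{s_1^L\in\phi^{-1}(\pi)}p(s_1^L)$. $H(S_1^L)=-\sum_{s_1^L\in A_n^L}p(s_1^L)\log p(s_1^L)$ and $H^*(S_1^L)=-\sum_{\pi\in\mathcal{S}_L}p(\pi)\log p(\pi)$ (with $0\log 0=0$). The entropy rate is $h(\mathbf{S})=\lim_{L\to\infty}\frac1L H(S_1^L)$ and the permutation entropy rate is $h^*(\mathbf{S})=\lim_{L\to\infty}\frac1L H^*(S_1^L)$; both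 limits exist for every finite-state stationary stochastic process. *)

(* Defs.v *)
From mathcomp Require Import all_boot all_order all_algebra all_fingroup.
From mathcomp Require Import all_classical all_reals all_analysis.
Import Order.TTheory GRing.Theory Num.Theory.
Import numFieldNormedType.Exports.

Set Implicit Arguments.
Unset Strict Implicit.
Unset Printing Implicit Defensive.

Local Open Scope classical_set_scope.
Local Open Scope ring_scope.

(* Everything is indexed from 0: the letters 1, ..., n are the elements of
   'I_n, the variable S_(i+1) of the process is [S i], the letter s_(i+1) of a
   word is [tnth s i], and the permutations of {1, ..., L} are those of 'I_L.
   Only the orders on letters and positions matter, and they are preserved. *)

Section Types.
Context {n L : nat}.
Implicit Types (s : L.-tuple 'I_n) (pi : 'S_L).

Definition of_type s pi : bool :=
  [forall i : 'I_L, forall j : 'I_L, (j == i.+1 :> nat) ==>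
    ((tnth s (pi i) <= tnth s (pi j))%N &&
     ((tnth s (pi i) == tnth s (pi j)) ==> (pi i < pi j)%N))].

(* The default value is never used, see [word_typeE]. *)
Definition word_type s : 'S_L := odflt 1%g [pick pi | of_type s pi].

Let lexr s : rel 'I_L := fun i j =>
  (tnth s i < tnth s j)%N || ((tnth s i == tnth s j) && (i <= j)%N).

Let lexr_trans s : transitive (lexr s).
Proof.
move=> y x z /orP[xy|/andP[/eqP exy xy]] /orP[yz|/andP[/eqP eyz yz]].
- by apply/orP; left; exact: ltn_trans xy yz.
- by apply/orP; left; rewrite -eyz.
- by apply/orP; left; rewrite exy.
- by apply/orP; right; rewrite exy eyz eqxx (leq_trans xy yz).
Qed.

Let lexr_total s : total (lexr s).
Proof.
move=> x y; rewrite /lexr.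
have [//|//|e] := ltngtP (tnth s x) (tnth s y); first by rewrite orbT.
by rewrite (val_inj e) eqxx /= leq_total.
Qed.

Let lexr_anti s : antisymmetric (lexr s).
Proof.
move=> x y /andP[/orP[xy|/andP[/eqP e xy]] /orP[yx|/andP[/eqP e' yx]]].
- by have := ltn_trans xy yx; rewrite ltnn.
- by rewrite e' ltnn in xy.
- by rewrite e ltnn in yx.
- by apply/val_inj/eqP; rewrite eqn_leq xy yx.
Qed.

Let of_typeE s pi :
  of_type s pi = sorted (lexr s) [seq pi i | i <- enum 'I_L].
Proof.
have nthE (x0 i : 'I_L) : nth x0 [seq pi i | i <- enum 'I_L] i = pi i.
  by rewrite (nth_map x0) ?size_enum_ord // nth_ord_enum.
apply/idP/idP => [/forallP H|].
  have [L0|L0] := posnP L.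
    by rewrite (size0nil (_ : size (enum 'I_L) = 0%N)) ?size_enum_ord.
  pose x0 := Ordinal L0.
  apply/(sortedP x0) => i; rewrite size_map size_enum_ord => il.
  have /forallP/(_ (Ordinal il)) := H (Ordinal (ltnW il)).
  have /= -> := nthE x0 (Ordinal il).
  have /= -> := nthE x0 (Ordinal (ltnW il)).
  rewrite eqxx /= => /andP[le lt]; apply/orP.
  case: eqP lt => [_ /= lt|ne _]; first by right; exact: ltnW.
  by left; rewrite ltn_neqAle le andbT; apply/eqP => /val_inj.
move=> srt; apply/forallP => i; apply/forallP => j; apply/implyP => /eqP ji.
move/(sortedP i): srt => /(_ i); rewrite size_map size_enum_ord -ji.
move=> /(_ (ltn_ord j)); rewrite !nthE => /orP[lt|/andP[/eqP e le]].
  by rewrite ltnW //=; apply/implyP => /eqP e; rewrite e ltnn in lt.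
rewrite e leqnn eqxx /= ltn_neqAle le andbT.
apply/eqP => /val_inj/perm_inj ij.
by have := ltnn i; rewrite -[X in (_ < X)%N]/(nat_of_ord i) {2}ij ji ltnSn.
Qed.

Lemma of_type_uniq s pi pi' : of_type s pi -> of_type s pi' -> pi = pi'.
Proof.
rewrite !of_typeE => h h'.
have /eq_in_map e : [seq pi i | i <- enum 'I_L] = [seq pi' i | i <- enum 'I_L].
  apply: (sorted_eq (@lexr_trans s) (@lexr_anti s) h h').
  have U (r : 'S_L) : uniq [seq r i | i <- enum 'I_L].
    by rewrite map_inj_uniq; [exact: enum_uniq | exact: perm_inj].
  apply: uniq_perm => //.
  move=> x; transitivity true; [|symmetry]; apply/mapP.
    by exists (pi^-1%g x); rewrite ?mem_enum ?permKV.
  by exists (pi'^-1%g x); rewrite ?mem_enum ?permKV.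
by apply/permP => i; apply: e; rewrite mem_enum.
Qed.

Lemma of_type_exists s : exists pi, of_type s pi.
Proof.
pose t := sort (lexr s) (enum 'I_L).
have st : size t = L by rewrite size_sort size_enum_ord.
have ut : uniq t by rewrite sort_uniq enum_uniq.
have fi : injective (fun i : 'I_L => nth i t i).
  move=> i j; rewrite (set_nth_default i j) ?st // => /eqP.
  by rewrite nth_uniq ?st // => /eqP/val_inj.
exists (perm fi); rewrite of_typeE.
suff -> : [seq perm fi i | i <- enum 'I_L] = t.
  by apply: sort_sorted; exact: lexr_total.
have [L0|L0] := posnP L.
  apply: etrans (esym (size0nil (etrans st L0))).
  by apply: size0nil; rewrite size_map size_enum_ord.
apply: (@eq_from_nth _ (Ordinal L0)); rewrite size_map size_enum_ord ?st //.
move=> i iL; rewrite (nth_map (Ordinal L0)) ?size_enum_ord //.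
have /= -> := nth_ord_enum (Ordinal L0) (Ordinal iL).
by rewrite permE; apply: set_nth_default; rewrite st.
Qed.

Lemma word_typeE s pi : (word_type s == pi) = of_type s pi.
Proof.
rewrite /word_type; case: pickP => [pi' h|h] /=.
  by apply/eqP/idP => [<- //|]; exact: of_type_uniq.
by have [pi' h'] := of_type_exists s; rewrite h in h'.
Qed.

End Types.

Section Process.
Context d (T : measurableType d) (R : realType) (P : probability T R) (n : nat).
Implicit Type S : nat -> T -> 'I_n.

(* The event S_(k+1) = s_1, ..., S_(k+L) = s_L. *)
Definition word_event S (k : nat) L (s : L.-tuple 'I_n) : set T :=
  [set w | forall i : 'I_L, S (k + i)%N w = tnth s i].

Definition stationary S : Prop :=
  forall (k L : nat) (s : L.-tuple 'I_n), (0 < k)%N -> (0 < L)%N ->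
    P (word_event S 0 s) = P (word_event S k s).

Definition word_prob S L (s : L.-tuple 'I_n) : R := fine (P (word_event S 0 s)).

Definition type_prob S L (pi : 'S_L) : R :=
  \sum_(s : L.-tuple 'I_n | word_type s == pi) word_prob S s.

Definition log2 (x : R) : R := ln x / ln 2.

Definition entropy S (L : nat) : R :=
  - \sum_(s : L.-tuple 'I_n) word_prob S s * log2 (word_prob S s).

Definition perm_entropy S (L : nat) : R :=
  - \sum_(pi : 'S_L) type_prob S pi * log2 (type_prob S pi).

Definition entropy_rate_seq S : nat -> R := fun L => entropy S L / L%:R.

Definition perm_entropy_rate_seq S : nat -> R :=
  fun L => perm_entropy S L / L%:R.

Definition entropy_rate S : R := limn (entropy_rate_seq S).

Definition perm_entropy_rate S : R := limn (perm_entropy_rate_seq S).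

End Process.

(* Main.v *)
(** The types of words induce a partition of A_n^L. Reading a word in the order
    of its type sorts it, so on each class a word is determined by its letter
    counts, and a class has at most (L+1)^n elements. Hence, by Gibbs'
    inequality, H* <= H <= H* + n log (L+1) for blocks of length L, and the gap
    vanishes after division by L. The entropy rate itself exists by Fekete's
    lemma, stationarity making L |-> H(S_1^L) subadditive. *)

Require Import Defs.
From mathcomp Require Import all_boot all_order all_algebra all_fingroup.
From mathcomp Require Import all_classical all_reals all_analysis.
From mathcomp Require Import ring lra.
Import Order.TTheory GRing.Theory Num.Theory.
Import numFieldNormedType.Exports.

Set Implicit Arguments.
Unset Strict Implicit.
Unset Printing Implicit Defensive.

Local Open Scope classical_set_scope.
Local Open Scope ring_scope.

(** * Base-2 logarithms and Gibbs' inequality *)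

Lemma ln2_gt0 (R : realType) : 0 < ln 2 :> R.
Proof. by apply: ln_gt0; rewrite ltr1n. Qed.

Lemma ln_le_subr1 (R : realType) (x : R) : 0 < x -> ln x <= x - 1.
Proof.
move=> x0; rewrite -[in leLHS](subrKC 1 x) le_ln1Dx//.
by rewrite ltrBDr addNr.
Qed.

Lemma log2M (R : realType) (x y : R) :
  0 < x -> 0 < y -> log2 (x * y) = log2 x + log2 y.
Proof. by move=> x0 y0; rewrite /log2 lnM ?posrE// mulrDl. Qed.

Lemma log2V (R : realType) (x : R) : 0 < x -> log2 x^-1 = - log2 x.
Proof. by move=> x0; rewrite /log2 lnV ?posrE// mulNr. Qed.

Lemma log2Xn (R : realType) (n : nat) (x : R) :
  0 < x -> log2 (x ^+ n) = n%:R * log2 x.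
Proof. by move=> x0; rewrite /log2 lnXn// -[ln x *+ n]mulr_natl mulrA. Qed.

Lemma log2_le0 (R : realType) (x : R) : x <= 1 -> log2 x <= 0.
Proof. by move=> x1; rewrite /log2 pmulr_lle0 ?invr_gt0 ?ln2_gt0// ln_le0. Qed.

Lemma ler_log2 (R : realType) (x y : R) : 0 < x -> x <= y -> log2 x <= log2 y.
Proof.
move=> x0 xy; rewrite /log2 ler_pM2r ?invr_gt0 ?ln2_gt0//.
by rewrite ler_ln ?posrE// (lt_le_trans x0).
Qed.

(** Termwise, [ln x <= x - 1] at [x = q i / p i]. Asking only for [\sum_i q i <= \sum_i p i] admits
    a [q] that falls short of total mass 1. *)
Lemma gibbs (R : realType) (I : finType) (p q : I -> R) :
  (forall i, 0 <= p i) -> (forall i, 0 <= q i) ->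
  (forall i, 0 < p i -> 0 < q i) -> \sum_i q i <= \sum_i p i ->
  \sum_i p i * log2 (q i) <= \sum_i p i * log2 (p i).
Proof.
move=> p0 q0 pq qp; rewrite -subr_le0 -sumrB.
suff H i : p i * log2 (q i) - p i * log2 (p i) <= (q i - p i) / ln 2.
  apply: (le_trans (ler_sum _ (fun i _ => H i))).
  by rewrite -mulr_suml pmulr_lle0 ?invr_gt0 ?ln2_gt0// sumrB subr_le0.
have := p0 i; rewrite le_eqVlt => /predU1P[<-|pi0].
  by rewrite !mul0r !subr0 mulr_ge0// invr_ge0 ltW// ln2_gt0.
have qi0 := pq _ pi0.
rewrite -mulrBr -mulrBl mulrA ler_pM2r ?invr_gt0 ?ln2_gt0//.
rewrite -ln_div ?posrE// [leLHS]mulrC -ler_pdivlMr// mulrBl divff ?gt_eqF//.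
by rewrite ln_le_subr1// divr_gt0.
Qed.

(** * Limits of real sequences *)

(** With [r = sqrt (L + 1)], the numerator is [2 * log2 r] and [L = (r + 1) * (r - 1)], so
    [ln r <= r - 1] bounds the quotient by [2 / (ln 2 * (r + 1))]. *)
Lemma log_over_id_cvg0 (R : realType) :
  (fun L => log2 L.+1%:R / L%:R : R) @ \oo --> 0.
Proof.
apply/cvgrPdist_le => e e0; near=> L.
have L0 : 0 < L%:R :> R by rewrite ltr0n; near: L; exact: nbhs_infty_gt.
have l2 := ln2_gt0 R.
have lg0 : 0 <= log2 L.+1%:R :> R by rewrite divr_ge0 ?ln_ge0 ?ler1n// ltW.
rewrite sub0r normrN ger0_norm; last by rewrite divr_ge0// ltW.
rewrite ler_pdivrMr//.
have LS : 0 < L.+1%:R :> R by rewrite ltr0n.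
have -> : log2 L.+1%:R = 2 * log2 (Num.sqrt L.+1%:R) :> R.
  by rewrite -log2Xn ?sqrtr_gt0// sqr_sqrtr// ltW.
set r := Num.sqrt _.
have r0 : 0 < r by rewrite sqrtr_gt0.
have rE : L%:R = r ^+ 2 - 1 by rewrite sqr_sqrtr ?ltW// -natr1 addrK.
have lr := ln_le_subr1 r0.
have r1 : 1 <= r by rewrite -[leLHS]sqrtr1 ler_wsqrtr// ler1n.
(* True as soon as [L >= (2 / (e * ln 2)) ^+ 2], because [r ^+ 2 = L + 1]. *)
have er : 2 <= e * ln 2 * r.
  have el0 : 0 < e * ln 2 by rewrite mulr_gt0.
  rewrite mulrC -ler_pdivrMr// -ler_sqr ?nnegrE ?(ltW r0)//; last first.
    by rewrite divr_ge0// ltW.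
  rewrite sqr_sqrtr ?(ltW LS)//; apply: (@le_trans _ _ L%:R); last first.
    by rewrite ler_nat.
  near: L; exact: nbhs_infty_ger.
rewrite /log2 mulrA ler_pdivrMr// rE mulrAC.
have -> : r ^+ 2 - 1 = (r + 1) * (r - 1) by ring.
rewrite mulrA; apply: (@le_trans _ _ (2 * (r - 1))).
  by rewrite ler_pM2l.
apply: ler_wpM2r; first by rewrite subr_ge0.
by rewrite mulrDr (le_trans er)// lerDl mulr1 mulr_ge0 ?ltW.
Unshelve. all: by end_near. Qed.

(** The limit is the infimum of [u L / L] over [L >= 1]: Euclidean division of [L] by a near-optimal
    [m] bounds [u L] by [(L %/ m) * u m] plus a term independent of [L]. *)
Lemma fekete (R : realType) (u : nat -> R) : (forall k, 0 <= u k) ->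
  (forall m k, u (m + k)%N <= u m + u k) -> cvgn (fun L => u L / L%:R).
Proof.
move=> u0 us.
have uM m q r : u (q * m + r)%N <= q%:R * u m + r%:R * u 1%N + u 0%N.
  elim: q r => [|q IH] r; last first.
    by rewrite mulSn -addnA (le_trans (us _ _))// -natr1; have := IH r; lra.
  rewrite mul0r add0r mul0n add0n; elim: r => [|r IH]; first by rewrite mul0r add0r.
  by rewrite -addn1 (le_trans (us _ _))// addn1 -natr1; lra.
(* The shift keeps out [L = 0], where the quotient is 0 by convention and would force the infimum to
   be 0. *)
pose E := [set u L.+1 / L.+1%:R | L in [set: nat]].
have lbE : has_lbound E.
  by exists 0 => _ [L _ <-]; rewrite divr_ge0.
have hE : has_inf E by split => //; exists (u 1%N / 1); exists 0%N.
apply/cvg_ex; exists (inf E); apply/cvgrPdist_le => e e0.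
have [_ [m' _ <-]] := inf_adherent (divr_gt0 e0 (ltr0n _ 2)) hE.
set m := m'.+1 => um.
near=> L.
have L0 : (0 < L)%N by near: L; exact: nbhs_infty_gt.
have L0' : 0 < L%:R :> R by rewrite ltr0n.
have iL : inf E <= u L / L%:R by apply: ge_inf => //; exists L.-1 => //; rewrite prednK.
rewrite distrC ger0_norm ?subr_ge0// lerBlDl.
have m0 : 0 < m%:R :> R by rewrite ltr0n.
(* Past this threshold the remainder of the division costs at most [e / 2 * L]; the other [e / 2]
   comes from the choice of [m]. *)
have HL : (m%:R * u 1%N + u 0%N) / (e / 2) <= L%:R.
  near: L; exact: nbhs_infty_ger.
rewrite ler_pdivrMr ?divr_gt0// in HL.
rewrite ler_pdivrMr// {1}(divn_eq L m) (le_trans (uM _ _ _))//.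
have h1 : (L %/ m)%:R * u m <= (inf E + e / 2) * L%:R.
  have -> : u m = u m / m%:R * m%:R by rewrite divfK// gt_eqF.
  rewrite mulrCA; apply: ler_pM; rewrite ?divr_ge0 ?mulr_ge0//; first exact: ltW.
  by rewrite -natrM ler_nat leq_trunc_div.
have h2 : (L %% m)%:R * u 1%N <= m%:R * u 1%N.
  by apply: ler_wpM2r => //; rewrite ler_nat ltnW// ltn_mod.
lra.
Unshelve. all: by end_near. Qed.

(** * Combinatorics of words: type classes and concatenation *)

Lemma word_type_sorted (n L : nat) (s : L.-tuple 'I_n) :
  sorted leq [seq nat_of_ord (tnth s (word_type s i)) | i <- enum 'I_L].
Proof.
have : of_type s (word_type s) by rewrite -word_typeE.
move=> /forallP H; have [L0|L0] := posnP L.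
  by rewrite (size0nil (_ : size (enum 'I_L) = 0%N)) ?size_enum_ord.
apply/(sortedP 0%N) => i; rewrite size_map size_enum_ord => il.
have nthE (j : 'I_L) :
    nth 0%N [seq nat_of_ord (tnth s (word_type s i)) | i <- enum 'I_L] j =
    tnth s (word_type s j).
  by rewrite (nth_map j) ?size_enum_ord// nth_ord_enum.
have /forallP/(_ (Ordinal il)) := H (Ordinal (ltnW il)).
rewrite (nthE (Ordinal il)) (nthE (Ordinal (ltnW il))).
by rewrite eqxx => /andP[].
Qed.

(** Letter counts are injective on a type class: read along [pi], two words with equal counts give
    sorted lists with the same entries, hence the same list. *)
Lemma card_word_type_fiber (n L : nat) (pi : 'S_L) :
  (#|[pred s : L.-tuple 'I_n | word_type s == pi]| <= L.+1 ^ n)%N.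
Proof.
pose f (s : L.-tuple 'I_n) : {ffun 'I_n -> 'I_L.+1} :=
  [ffun a => inord (count_mem a s)].
(* A count is at most [L], so [inord] never returns its default. *)
have fE s a : f s a = count_mem a s :> nat.
  by rewrite ffunE inordK// ltnS -{2}(size_tuple s) count_size.
have -> : (L.+1 ^ n)%N = #|{ffun 'I_n -> 'I_L.+1}|.
  by rewrite card_ffun !card_ord.
apply: (@leq_card_in _ _ f).
move=> s s'; rewrite !inE => /eqP sp /eqP s'p ff.
have ss' : perm_eq s s'.
  apply/allP => a _ /=; apply/eqP.
  by have := congr1 (fun g : {ffun 'I_n -> 'I_L.+1} => nat_of_ord (g a)) ff; rewrite !fE.
have pe (t : L.-tuple 'I_n) :
    perm_eq [seq nat_of_ord (tnth t (pi i)) | i <- enum 'I_L] (map val t).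
  have -> : map val t = [seq nat_of_ord (tnth t i) | i <- enum 'I_L].
    by rewrite -[in LHS](map_tnth_enum t) -map_comp.
  rewrite (map_comp (fun i => nat_of_ord (tnth t i)) pi).
  apply: perm_map; apply: uniq_perm.
  - by rewrite map_inj_uniq ?enum_uniq//; exact: perm_inj.
  - exact: enum_uniq.
  move=> i; rewrite mem_enum; apply/mapP.
  by exists (pi^-1%g i); rewrite ?mem_enum ?permKV.
have /eq_in_map e : [seq nat_of_ord (tnth s (pi i)) | i <- enum 'I_L] =
          [seq nat_of_ord (tnth s' (pi i)) | i <- enum 'I_L].
  apply: (sorted_eq leq_trans anti_leq).
  - by rewrite -sp word_type_sorted.
  - by rewrite -s'p word_type_sorted.
  apply: (perm_trans (pe s)); rewrite perm_sym; apply: (perm_trans (pe s')).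
  by rewrite perm_sym perm_map.
apply: eq_from_tnth => i; apply: val_inj.
by have := e (pi^-1%g i); rewrite permKV mem_enum; apply.
Qed.

Lemma big_cat_tuple (T : finType) (R : Type) (idx : R)
    (op : Monoid.com_law idx) (m k : nat) (F : (m + k).-tuple T -> R) :
  \big[op/idx]_u F u =
  \big[op/idx]_(s : m.-tuple T) \big[op/idx]_(t : k.-tuple T) F (cat_tuple s t).
Proof.
rewrite pair_bigA/= (reindex (fun x : m.-tuple T * k.-tuple T => cat_tuple x.1 x.2))//.
exists (fun u : (m + k).-tuple T =>
  ([tuple tnth u (lshift k i) | i < m], [tuple tnth u (rshift m i) | i < k])).
  move=> [s t] _; congr (_, _); apply: eq_from_tnth => i.
    by rewrite tnth_mktuple/= tnth_lshift.
  by rewrite tnth_mktuple/= tnth_rshift.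
move=> u _; apply: eq_from_tnth => i; case: (split_ordP i) => j ->.
  by rewrite tnth_lshift tnth_mktuple.
by rewrite tnth_rshift tnth_mktuple.
Qed.

(** * Word probabilities, their marginals and subadditivity of the entropy *)

Section Process.
Context (R : realType) (d : measure_display) (T : measurableType d)
  (P : probability T R) (n : nat) (S : nat -> T -> 'I_n).
Context (mS : forall (i : nat) (a : 'I_n), measurable (S i @^-1` [set a])).

Lemma measurable_word_event k L (s : L.-tuple 'I_n) :
  measurable (word_event S k s).
Proof.
have -> : word_event S k s =
    \big[setI/setT]_(i < L) (S (k + i)%N @^-1` [set tnth s i]).
  by rewrite -bigcap_seq; apply/seteqP; split=> [w sw i _ |w sw i];
    [exact: sw|apply: (sw i); rewrite /= mem_index_enum].
by apply: bigsetI_measurable.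
Qed.

Lemma word_event_cat m k (s : m.-tuple 'I_n) (t : k.-tuple 'I_n) :
  word_event S 0 (cat_tuple s t) = word_event S 0 s `&` word_event S m t.
Proof.
apply/seteqP; split=> [w st|w [ws wt] i].
  split=> i; [have := st (lshift k i)|have := st (rshift m i)].
    by rewrite tnth_lshift.
  by rewrite tnth_rshift.
case: (split_ordP i) => j ->.
  by rewrite tnth_lshift; exact: ws.
by rewrite tnth_rshift; exact: wt.
Qed.

(** At each point the block of length [L] after time [k] spells exactly one word, so the word events
    partition the space. *)
Lemma measure_word_partition k L (A : set T) : measurable A ->
  P A = (\sum_(s : L.-tuple 'I_n) P (A `&` word_event S k s))%E.
Proof.
move=> mA; rewrite [RHS]fsbig_seq ?index_enum_uniq//.
rewrite -measure_fin_bigcup//; first last.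
- by move=> s _; apply: measurableI => //; exact: measurable_word_event.
- apply/trivIsetP => s t _ _ /eqP st; apply/seteqP; split=> // w [[_ ws] [_ wt]].
  by apply: st; apply: eq_from_tnth => i; rewrite -ws wt.
congr (P _); apply/seteqP; split=> [w Aw|w [s _ []//]].
exists [tuple S (k + i)%N w | i < L]; first by rewrite /= mem_index_enum.
by split=> // i; rewrite tnth_mktuple.
Qed.

Lemma word_probE L (s : L.-tuple 'I_n) :
  (word_prob P S s)%:E = P (word_event S 0 s).
Proof. by rewrite fineK// fin_num_measure//; exact: measurable_word_event. Qed.

Lemma word_prob_ge0 L (s : L.-tuple 'I_n) : 0 <= word_prob P S s.
Proof. by rewrite fine_ge0. Qed.

Lemma sum_word_prob L : \sum_(s : L.-tuple 'I_n) word_prob P S s = 1.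
Proof.
apply: EFin_inj; rewrite -sumEFin -(@probability_setT _ _ _ P).
rewrite (@measure_word_partition 0 L)//.
by apply: eq_bigr => s _; rewrite word_probE setTI.
Qed.

Lemma word_prob_le1 L (s : L.-tuple 'I_n) : word_prob P S s <= 1.
Proof.
rewrite -(sum_word_prob L) (bigD1 s)//= lerDl.
by apply: sumr_ge0 => t _; exact: word_prob_ge0.
Qed.

Lemma sum_word_prob_suffix m k (s : m.-tuple 'I_n) :
  \sum_(t : k.-tuple 'I_n) word_prob P S (cat_tuple s t) = word_prob P S s.
Proof.
apply: EFin_inj; rewrite -sumEFin word_probE.
rewrite (@measure_word_partition m k); last exact: measurable_word_event.
by apply: eq_bigr => t _; rewrite word_probE word_event_cat.
Qed.

(** Summing out the first [m] letters leaves the event of [t] at offset [m], which stationarity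
    moves back to offset 0. *)
Lemma sum_word_prob_prefix m k (t : k.-tuple 'I_n) : stationary P S ->
  \sum_(s : m.-tuple 'I_n) word_prob P S (cat_tuple s t) = word_prob P S t.
Proof.
move=> statS; apply: EFin_inj; rewrite -sumEFin word_probE.
have -> : P (word_event S 0 t) = P (word_event S m t).
  (* [stationary] speaks of positive shifts and lengths. For [m = 0] the two events coincide; for
     [k = 0] both are the whole space. *)
  have [->//|m0] := posnP m; have [k0|k0] := posnP k; last exact: statS.
  by congr (P _); apply/seteqP; split=> w _ [i ik]; have := ik; rewrite {1}k0.
rewrite (@measure_word_partition 0 m); last exact: measurable_word_event.
by apply: eq_bigr => s _; rewrite word_probE word_event_cat setIC.
Qed.

Lemma entropy_ge0 L : 0 <= entropy P S L.
Proof.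
rewrite oppr_ge0 sumr_le0// => s _.
by rewrite mulr_ge0_le0 ?word_prob_ge0// log2_le0// word_prob_le1.
Qed.

(** Gibbs' inequality for the joint law [p] of two adjacent blocks against the product [q] of their
    laws. *)
Lemma entropy_subadditive m k : stationary P S ->
  entropy P S (m + k) <= entropy P S m + entropy P S k.
Proof.
move=> statS; rewrite /entropy -opprD lerN2 big_cat_tuple.
pose p (x : m.-tuple 'I_n * k.-tuple 'I_n) := word_prob P S (cat_tuple x.1 x.2).
pose q (x : m.-tuple 'I_n * k.-tuple 'I_n) := word_prob P S x.1 * word_prob P S x.2.
rewrite pair_bigA/=.
(* Each marginal is a sum of nonnegative terms that includes [p x]. This gives the support condition
   of [gibbs] and later lets the logarithm of the product split. *)
have pq x : 0 < p x -> (0 < word_prob P S x.1) /\ (0 < word_prob P S x.2).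
  move=> px; split; apply: (lt_le_trans px).
    rewrite -(sum_word_prob_suffix k) (bigD1 x.2)//= lerDl.
    by apply: sumr_ge0 => t _; exact: word_prob_ge0.
  rewrite -(sum_word_prob_prefix m _ statS) (bigD1 x.1)//= lerDl.
  by apply: sumr_ge0 => t _; exact: word_prob_ge0.
apply: le_trans (@gibbs _ _ p q _ _ _ _); last 4 first.
- by move=> x; exact: word_prob_ge0.
- by move=> x; rewrite mulr_ge0 ?word_prob_ge0.
- by move=> x /pq[? ?]; rewrite mulr_gt0.
- rewrite -(pair_bigA _ (fun s t => word_prob P S s * word_prob P S t))/=.
  rewrite -(pair_bigA _ (fun s t => word_prob P S (cat_tuple s t)))/=.
  rewrite -big_distrlr/= !sum_word_prob mulr1.
  by under eq_bigr do rewrite sum_word_prob_suffix; rewrite sum_word_prob.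
rewrite (eq_bigr (fun x => p x * log2 (word_prob P S x.1) +
                           p x * log2 (word_prob P S x.2))); last first.
  move=> x _; have := word_prob_ge0 (cat_tuple x.1 x.2).
  rewrite le_eqVlt => /predU1P[e|/pq[? ?]]; last by rewrite log2M// mulrDr.
  by rewrite /p -e !mul0r addr0.
(* In each half, summing out the other block leaves a marginal, hence the entropy sum of a single
   block. *)
rewrite big_split/=; apply: lerD.
  rewrite -(pair_bigA _ (fun s t => p (s, t) * log2 (word_prob P S s)))/=.
  by apply: ler_sum => s _; rewrite -mulr_suml sum_word_prob_suffix.
rewrite -(pair_bigA _ (fun s t => p (s, t) * log2 (word_prob P S t)))/=.
rewrite exchange_big/=; apply: ler_sum => t _.
by rewrite -mulr_suml sum_word_prob_prefix.
Qed.

(** * Comparison of entropy and permutation entropy *)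

Lemma word_prob_le_type L (s : L.-tuple 'I_n) :
  word_prob P S s <= type_prob P S (word_type s).
Proof.
rewrite /type_prob (bigD1 s)//= lerDl.
by apply: sumr_ge0 => t _; exact: word_prob_ge0.
Qed.

(** Both entropies become averages over words with the same weights, so they can be compared term by
    term. *)
Lemma perm_entropyE L : perm_entropy P S L =
  - \sum_(s : L.-tuple 'I_n)
      word_prob P S s * log2 (type_prob P S (word_type s)).
Proof.
congr (- _); rewrite [RHS](partition_big (@word_type n L) xpredT)//=.
apply: eq_bigr => pi _; rewrite {1}/type_prob mulr_suml.
by apply: eq_bigr => s /eqP ->.
Qed.

Lemma perm_entropy_le_entropy L : perm_entropy P S L <= entropy P S L.
Proof.
rewrite perm_entropyE lerN2; apply: ler_sum => s _.
have := word_prob_ge0 s; rewrite le_eqVlt => /predU1P[<-|s0].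
  by rewrite !mul0r.
by rewrite ler_wpM2l ?word_prob_ge0// ler_log2// word_prob_le_type.
Qed.

Lemma entropy_le_perm_entropy L :
  entropy P S L <= perm_entropy P S L + n%:R * log2 L.+1%:R.
Proof.
pose N : R := L.+1%:R ^+ n.
have N0 : 0 < N by rewrite exprn_gt0// ltr0n.
pose q (s : L.-tuple 'I_n) := type_prob P S (word_type s) / N.
have t0 (pi : 'S_L) : 0 <= type_prob P S pi.
  by apply: sumr_ge0 => s _; exact: word_prob_ge0.
(* Compare with the measure spreading each type's mass over [N] words. *)
have : \sum_s word_prob P S s * log2 (q s) <=
       \sum_(s : L.-tuple 'I_n) word_prob P S s * log2 (word_prob P S s).
  apply: gibbs; first exact: word_prob_ge0.
  - by move=> s; rewrite divr_ge0// ltW.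
  - by move=> s s0; rewrite divr_gt0// (lt_le_trans s0)// word_prob_le_type.
  (* The mass of [q] is bounded class by class: at most [N] words, each of weight
     [type_prob P S pi / N]. *)
  rewrite [leLHS](partition_big (@word_type n L) xpredT)//=.
  rewrite [leRHS](partition_big (@word_type n L) xpredT)//=.
  apply: ler_sum => pi _.
  rewrite (eq_bigr (fun=> type_prob P S pi / N)); last first.
    by move=> s /eqP <-.
  rewrite sumr_const -mulr_natr mulrAC -mulrA.
  apply: ler_piMr => //.
  rewrite ler_pdivrMr// mul1r /N -natrX ler_nat.
  exact: card_word_type_fiber.
rewrite -lerN2 => /le_trans; apply; rewrite perm_entropyE.
(* [log2 (q s)] splits off the constant [log2 N], whose weights sum to 1. *)
rewrite (eq_bigr (fun s : L.-tuple 'I_n =>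
    word_prob P S s * log2 (type_prob P S (word_type s)) -
    word_prob P S s * (n%:R * log2 L.+1%:R))); last first.
  move=> s _; have := word_prob_ge0 s; rewrite le_eqVlt => /predU1P[<-|s0].
    by rewrite !mul0r subr0.
  rewrite -mulrBr log2M ?invr_gt0// ?log2V// ?log2Xn ?ltr0n//.
  by rewrite (lt_le_trans s0)// word_prob_le_type.
by rewrite sumrB -mulr_suml sum_word_prob mul1r opprB addrC.
Qed.

End Process.

Theorem theorem11 (n : nat) (hn : (1 <= n)%N) (R : realType)
    (d : measure_display) (T : measurableType d) (P : probability T R)
    (S : nat -> T -> 'I_n)
    (mS : forall (i : nat) (a : 'I_n), measurable (S i @^-1` [set a]))
    (statS : stationary P S) :
  [/\ cvgn (entropy_rate_seq P S), cvgn (perm_entropy_rate_seq P S)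
    & entropy_rate P S = perm_entropy_rate P S].
Proof.
have cH : cvgn (entropy_rate_seq P S).
  apply: fekete => [k|m k]; first exact: entropy_ge0.
  exact: entropy_subadditive.
have cH' : perm_entropy_rate_seq P S @ \oo --> limn (entropy_rate_seq P S).
  apply: (@squeeze_cvgr _ _ _ _ (fun L =>
      entropy_rate_seq P S L - n%:R * (log2 L.+1%:R / L%:R)) (entropy_rate_seq P S)).
  (* The bounds hold for every [L], including [L = 0], since only the nonnegativity of the inverse
     of [L] enters. *)
  - apply: nearW => L; rewrite mulrA -mulrBl.
    rewrite !ler_wpM2r ?invr_ge0//; first by rewrite perm_entropy_le_entropy.
    by rewrite lerBlDr entropy_le_perm_entropy.
  - rewrite -[X in _ --> X]subr0 -[X in _ --> _ - X](mulr0 n%:R).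
    apply: cvgB => //; apply: cvgM; first exact: cvg_cst.
    exact: log_over_id_cvg0.
  - exact: cH.
split=> //; first by apply/cvg_ex; eexists; exact: cH'.
by apply/esym/cvg_lim.
Qed.
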